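(* Let $Z$ be a lush Banach space over $\mathbb{F}$ (where $\mathbb{F}=\mathbb{R}$ or $\mathbb{F}=\mathbb{C}$) and let $X\subseteq Z$ be an L-summand of $Z$. Then $X$, with the norm inherited from $Z$, is lush.
   Context: Let $\mathbb{F}$ be $\mathbb{R}$ or $\mathbb{C}$ and $\mathbb{T}=\{\omega\in\mathbb{F}: |\omega|=1\}$. For a Banach space $X$ over $\mathbb{F}$, $B_X$ denotes its closed unit ball, $S_X$ its unit sphere, and $X^*$ its dual. For $x^*\in S_{X^*}$ and $\alpha>0$ put $S(B_X,x^*,\alpha)=\{x\in B_X : \operatorname{Re} x^*(x)>1-\alpha\}$ (an open slice of the unit ball). For $F\subseteq X$, $\operatorname{co}(F)$ is the convex hull of $F$ and $\mathbb{T}F=\{\omega x:\omega\in\mathbb{T},x\in F\}$, so $\operatorname{co}(\mathbb{T}F)$ is the absolutely convex hull of $F$; $\operatorname{dist}(v,A)=\inf_{a\in A}\|v-a\|$. Lush: a Banach space $X$ is lush if for every $u,v\in S_X$ and every $\varepsilon>0$ there is $x^*\in S_{X^*}$ such that $u\in S(B_X,x^*,\varepsilon)$ and $\operatorname{dist}(v,\operatorname{co}(\mathbb{T}\,S(B_X,x^*,\varepsilon)))<\varepsilon$. L-summand: a linear projection $P:Z\to Z$ with $\|z\|=\|Pz\|+\|z-Pz\|$ for every $z\in Z$ is called an L-projection, and its range $\operatorname{ran}P$ is called an L-summand of $Z$. *)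

(* Defs.v *)
From HB Require Import structures.
From mathcomp Require Import all_boot all_order all_algebra.
From mathcomp Require Import complex.
From mathcomp Require Import all_classical all_reals all_analysis.

Set Implicit Arguments.
Unset Strict Implicit.
Unset Printing Implicit Defensive.

Import Order.TTheory GRing.Theory Num.Theory.
Import numFieldNormedType.Exports.

Local Open Scope classical_set_scope.
Local Open Scope ring_scope.

Variant field_kind := RealScalars | ComplexScalars.

Definition scalars (R : realType) (k : field_kind) : numFieldType :=
  match k with
  | RealScalars => R
  | ComplexScalars => R[i]
  end.

Definition re (R : realType) (k : field_kind) : scalars R k -> R :=
  match k with
  | RealScalars => fun x => x
  | ComplexScalars => fun x => complex.Re x
  end.

Section Lush.
Context {R : realType} {k : field_kind}.
Local Notation F := (scalars R k).

(* The norm of a normed module over [F] takes its values in [F]; they are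
   nonnegative, hence real, and [rnorm] reads them in [R]. *)
Definition rnorm (V : normedModType F) (x : V) : R := re `|x|.

Definition unit_ball (V : normedModType F) : set V := [set x | `|x| <= 1].

Definition unit_sphere (V : normedModType F) : set V := [set x | `|x| = 1].

(* On a continuous linear functional the supremum is that of a nonempty
   bounded set. *)
Definition dual_norm (V : normedModType F) (f : V -> F^o) : R :=
  sup [set rnorm (f x) | x in @unit_ball V].

Definition dual_sphere (V : normedModType F) : set {linear V -> F^o} :=
  [set f : {linear V -> F^o} | continuous f /\ dual_norm f = 1].

Definition slice (V : normedModType F) (f : V -> F^o) (a : R) : set V :=
  [set x | unit_ball x /\ 1 - a < re (f x)].

(* The weights in [convex_set] are the t : F with 0 <= t <= 1; for complex
   scalars this order relation forces t to be real. *)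
Definition convex_hull (V : normedModType F) (A : set V) : set V :=
  smallest (@convex_set F V) A.

Definition torus_mul (V : normedModType F) (A : set V) : set V :=
  [set w *: x | w in [set w : F | `|w| = 1] & x in A].

(* Extended-real valued: the distance to the empty set is +oo. *)
Definition dist_set (V : normedModType F) (v : V) (A : set V) : \bar R :=
  ereal_inf [set (rnorm (v - a))%:E | a in A].

Definition lush (X : completeNormedModType F) : Prop :=
  forall u v : X, unit_sphere u -> unit_sphere v ->
  forall eps : R, 0 < eps ->
  exists f : {linear X -> F^o},
    [/\ dual_sphere f, slice f eps u &
        (dist_set v (convex_hull (torus_mul (slice f eps))) < eps%:E)%E].

End Lush.

Definition is_Lprojection (K : numFieldType) (Z : normedModType K)
    (P : {linear Z -> Z}) : Prop :=
  (forall z, P (P z) = P z) /\ (forall z, `|z| = `|P z| + `|z - P z|).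

Definition is_Lsummand (K : numFieldType) (Z : normedModType K)
    (X : set Z) : Prop :=
  exists2 P : {linear Z -> Z}, is_Lprojection P & X = range P.

(* An L-summand as a Banach space: the subtype of the elements of [X], with
   the vector space structure and the norm inherited from [Z].  The proof
   argument [hX] only lets instance inference recover the linearity and the
   closedness of [X]. *)
Section Lsummand.
Context {K : numFieldType} {Z : completeNormedModType K} {X : set Z}.
Variable hX : is_Lsummand X.

Definition Lsummand_pred of is_Lsummand X : {pred Z} := fun x => x \in X.

Let Lsummand_submod : GRing.submod_closed (Lsummand_pred hX).
Proof.
have [P _ XE] := hX; split=> [|a x y]; rewrite !unfold_in /Lsummand_pred XE.
  by apply/mem_set; exists 0 => //; rewrite linear0.
move=> /set_mem[x' _ <-] /set_mem[y' _ <-].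
by apply/mem_set; exists (a *: x' + y') => //; rewrite linearP.
Qed.

HB.instance Definition _ :=
  GRing.isSubmodClosed.Build K Z (Lsummand_pred hX) Lsummand_submod.

Definition Lsummand : Type := {x : Z | Lsummand_pred hX x}.

HB.instance Definition _ := SubChoice.on Lsummand.
HB.instance Definition _ := [SubChoice_isSubLmodule of Lsummand by <:].

Definition Lsummand_norm (x : Lsummand) : K := `|val x|.

Let normD (x y : Lsummand) :
  Lsummand_norm (x + y) <= Lsummand_norm x + Lsummand_norm y.
Proof. exact: ler_normD. Qed.

Let normZ (l : K) (x : Lsummand) :
  Lsummand_norm (l *: x) = `|l| * Lsummand_norm x.
Proof. exact: normrZ. Qed.

Let norm_eq0 (x : Lsummand) : Lsummand_norm x = 0 -> x = 0.
Proof. by move=> /normr0_eq0 x0; apply/val_inj. Qed.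

HB.instance Definition _ :=
  Lmodule_isNormed.Build K Lsummand normD normZ norm_eq0.

Lemma Lsummand_normE (x : Lsummand) : `|x| = `|val x|.
Proof. by []. Qed.

Let Lsummand_complete (G : set_system Lsummand) :
  ProperFilter G -> cauchy G -> cvg G.
Proof.
move=> GF /cauchy_ballP Gc.
have valG : ProperFilter ((val : Lsummand -> Z) @ G) by exact: fmap_proper_filter.
have /cauchy_cvg : cauchy ((val : Lsummand -> Z) @ G).
  apply/cauchy_ballP => e e0; have := Gc _ e0.
  rewrite !near2E => -[[A B]/= [GA GB] AB].
  exists (val @` A, val @` B) => /=.
    by split; [apply: filterS GA|apply: filterS GB] => x ?; exists x.
  move=> [_ _] /= [[x Ax <-] [y By <-]].
  by have := AB (x, y) (conj Ax By); rewrite -!ball_normE.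
move=> /cvg_ex[l /cvgrPdist_lt Gl].
have [P [PP LP] XE] := hX.
have Pval (x : Lsummand) : P (val x) = val x.
  by case: x => x /=; rewrite /Lsummand_pred XE => /set_mem[z _ <-].
have lP : P l = l.
  apply/eqP; rewrite eq_sym -subr_eq0 -normr_le0; apply/ler_addgt0Pr => e e0.
  rewrite add0r.
  have /filter_ex[x /= lx] := Gl _ e0.
  rewrite (_ : l - P l = (l - val x) - P (l - val x)); last first.
    by rewrite linearB/= Pval opprB addrA subrK.
  by rewrite (le_trans _ (ltW lx))// [leRHS]LP lerDr.
have lX : Lsummand_pred hX l.
  by rewrite /Lsummand_pred XE; apply/mem_set; exists l.
apply/cvg_ex; exists (exist _ l lX : Lsummand).
by apply/cvgrPdist_lt => e e0; exact: Gl.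
Qed.

HB.instance Definition _ := Uniform_isComplete.Build Lsummand Lsummand_complete.

End Lsummand.

(* Main.v *)
Require Import Defs.
From HB Require Import structures.
From mathcomp Require Import all_boot all_order all_algebra.
From mathcomp Require Import complex.
From mathcomp Require Import all_classical all_reals all_analysis.
From mathcomp Require Import ring lra.

(** Write Z = X (+)_1 Y, where X is the range of the L-projection P, and let
u, v be unit vectors of X.  Lushness of Z at (u, v), with a small parameter
eta, gives a norm-one functional f on Z, almost attaining its norm at u, and a
combination w of rotated points of a thin slice of f with |v - w| < eta.

The L-norm enters twice.  For a point z of the ball of Z with |P z| > 1 - d,
the Y-component has norm less than d, so that f (P z) is as close to 1 as f z
up to d ([slice_projection]): such a P z belongs to a slice of the restriction
of f to X, and still does once that restriction is normalised, because its norm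
is at most 1 ([dual_sphere_normalize]).  The other points z
of the slice may have useless X-components, for instance 0, but they cannot
matter much in w: P w is an average of points P (omega z) of the unit ball and
is itself within eta of the unit vector v, so the points with |P z| <= 1 - d
carry a total weight of at most eta / d.  Replacing them by u moves P w by at
most 2 eta / d ([near_hull_of_large_points]).  Thus v is within
eta + 2 eta / d of the absolutely convex hull of the slice in X, and for
e = min(eps, 1) the choices d = e / 2 and eta = e^2 / 5 conclude. *)

Set Implicit Arguments.
Unset Strict Implicit.
Unset Printing Implicit Defensive.

Import Order.TTheory GRing.Theory Num.Theory.
Import numFieldNormedType.Exports.

Local Open Scope classical_set_scope.
Local Open Scope ring_scope.

(** * Real parts and real-valued norms *)

Section Scalars.
Context {R : realType} {k : field_kind}.
Local Notation F := (scalars R k).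
Implicit Types x y : F.

Definition scalar_of_real : R -> F :=
  match k with RealScalars => fun r => r | ComplexScalars => fun r => r%:C%C end.

Lemma re_is_zmod_morphism : zmod_morphism (@re R k).
Proof. by case: k => // -[? ?] [? ?]. Qed.

HB.instance Definition _ :=
  GRing.isZmodMorphism.Build F R (@re R k) re_is_zmod_morphism.

Lemma re_scalar_of_real r : re (scalar_of_real r) = r.
Proof. by rewrite /scalar_of_real; case: k. Qed.

Lemma re1 : re (1 : F) = 1.
Proof. by case: k. Qed.

Lemma scalar_of_real_re x : 0 <= x -> scalar_of_real (re x) = x.
Proof.
rewrite /scalar_of_real; case: k x => // -[a b]; rewrite lecE /= => /andP[/eqP-> _].
by [].
Qed.

Lemma re_le x y : x <= y -> re x <= re y.
Proof. by case: k x y => // -[a b] [c d]; rewrite lecE /= => /andP[]. Qed.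

Lemma scalar_of_real_ge0 r : 0 <= r -> 0 <= scalar_of_real r.
Proof. by rewrite /scalar_of_real; case: k => // r0; rewrite lecE /= eqxx. Qed.

Lemma re_inj_ge0 x y : 0 <= x -> 0 <= y -> re x = re y -> x = y.
Proof. by move=> /scalar_of_real_re {2}<- /scalar_of_real_re {2}<- ->. Qed.

Lemma le_re x y : 0 <= x -> 0 <= y -> (re x <= re y) = (x <= y).
Proof.
move=> x0 y0; apply/idP/idP; last exact: re_le.
have [//|yx] := real_leP (ger0_real x0) (ger0_real y0).
move=> xy; move: (yx); rewrite (@re_inj_ge0 x y) ?ltxx //.
by apply/eqP; rewrite eq_le xy re_le // ltW.
Qed.

Lemma reM_ge0 x y : 0 <= x -> re (x * y) = re x * re y.
Proof.
case: k x y => // -[a b] [c d]; rewrite lecE /= => /andP[/eqP-> _].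
by rewrite mul0r subr0.
Qed.

Lemma re_le_norm x : re x <= re `|x|.
Proof.
case: k x => [x|x]; first exact: ler_norm.
have := normc_ge_Re x; rewrite lecE /= => /andP[_].
exact: le_trans (ler_norm _).
Qed.

End Scalars.

Section Norm.
Context {R : realType} {k : field_kind}.
Local Notation F := (scalars R k).
Implicit Types V : normedModType F.

Lemma rnorm_ge0 V (x : V) : 0 <= rnorm x.
Proof. by rewrite /rnorm -(raddf0 (@re R k)); apply: re_le. Qed.

Lemma rnormD V (x y : V) : rnorm (x + y) <= rnorm x + rnorm y.
Proof. by rewrite /rnorm -raddfD; apply: re_le; exact: ler_normD. Qed.

Lemma rnormN V (x : V) : rnorm (- x) = rnorm x.
Proof. by rewrite /rnorm normrN. Qed.

Lemma rnormZ V (a : F) (x : V) : rnorm (a *: x) = re `|a| * rnorm x.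
Proof. by rewrite /rnorm normrZ reM_ge0. Qed.

Lemma rnormZ_ge0 V (a : F) (x : V) : 0 <= a -> rnorm (a *: x) = re a * rnorm x.
Proof. by move=> a0; rewrite rnormZ ger0_norm. Qed.

Lemma unit_ballE V (x : V) : unit_ball x <-> rnorm x <= 1.
Proof. by rewrite /unit_ball /= /rnorm -(@re1 R k) le_re. Qed.

Lemma unit_sphereE V (x : V) : unit_sphere x <-> rnorm x = 1.
Proof.
rewrite /unit_sphere /= /rnorm -(@re1 R k); split=> [->//|].
exact: re_inj_ge0.
Qed.

Lemma dist_set_ltP V (v : V) (A : set V) (e : R) :
  (dist_set v A < e%:E)%E <-> exists2 a, A a & rnorm (v - a) < e.
Proof.
split=> [/ereal_inf_lt[_ [a Aa <-]]|[a Aa ae]]; first by exists a.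
by apply/ereal_inf_ltP; exists (rnorm (v - a))%:E => //; exists a.
Qed.

End Norm.

(** * Convex hulls *)

Section Hull.
Context {R : realType} {k : field_kind}.
Local Notation F := (scalars R k).
Implicit Types V : normedModType F.

Lemma convex_setP V (A : set V) : @convex_set F V A <->
  forall (t : F) x y, 0 <= t <= 1 -> A x -> A y -> A (t *: x + (1 - t) *: y).
Proof.
split=> cA.
  move=> t x y /andP[t0 t1] /mem_set xA /mem_set yA; apply/set_mem.
  exact: (cA x y (Itv01 t0 t1)).
move=> x y t /set_mem xA /set_mem yA; apply/mem_set.
by apply: cA => //; apply/andP; split.
Qed.

Lemma convex_hull_convex V (A : set V) : @convex_set F V (convex_hull A).
Proof.
apply/convex_setP => t x y t01 Ax Ay B [cB AB].
by move/convex_setP: (cB); apply=> //; [apply: Ax|apply: Ay].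
Qed.

Lemma convex_hull_linear V (W : normedModType F) (p : {linear V -> W}) (A : set V) w :
  convex_hull A w -> convex_hull (p @` A) (p w).
Proof.
move=> Aw; apply: (Aw (p @^-1` convex_hull (p @` A))); split; last first.
  by move=> a Aa; apply: sub_gen_smallest; exists a.
apply/convex_setP => t x y t01 px py /=; rewrite linearD !linearZ.
by move/convex_setP: (@convex_hull_convex W (p @` A)); apply.
Qed.

(** A point of co(B) of norm near 1 is an average of points of B most of which
have norm above 1 - d, so it is near co(A), where A contains those.  The bound
is jointly convex in the point and its approximant, so it suffices to have it
on B: a point of norm above 1 - d is its own approximant, and u serves for the
others. *)
Lemma near_hull_of_large_points V (A B : set V) (u : V) (d : R) :
  0 <= d -> A u -> rnorm u <= 1 -> (forall b, B b -> rnorm b <= 1) ->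
  (forall b, B b -> 1 - d < rnorm b -> A b) ->
  forall c, convex_hull B c ->
  exists2 a, convex_hull A a & rnorm (c - a) * d <= 2 * (1 - rnorm c).
Proof.
move=> d0 Au u1 B1 BA c Bc; apply: (Bc [set c | exists2 a, convex_hull A a &
  rnorm (c - a) * d <= 2 * (1 - rnorm c)]); split => [|b Bb]; last first.
  have := B1 b Bb; have [bd|bd] := ltP (1 - d) (rnorm b) => b1.
    exists b; first by apply: sub_gen_smallest; exact: BA.
    by rewrite subrr /rnorm normr0 raddf0; rewrite /rnorm in b1; lra.
  exists u; first exact: sub_gen_smallest.
  have := rnormD b (- u); rewrite rnormN.
  by move=> /ler_wpM2r => /(_ d d0); nra.
apply/convex_setP => t x y /andP[t0 t1] [a Aa xa] [b Ab yb].
exists (t *: a + (1 - t) *: b).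
  move/convex_setP: (@convex_hull_convex V A); apply=> //; exact/andP.
rewrite opprD addrACA -!scalerBr.
have s0 : 0 <= 1 - t by rewrite subr_ge0.
have := rnormD (t *: x) ((1 - t) *: y).
have := rnormD (t *: (x - a)) ((1 - t) *: (y - b)).
have := re_le t0; have := re_le s0.
rewrite !rnormZ_ge0 // !raddfB raddf0 /= re1.
set r := re t; set m := rnorm _; set n := rnorm (_ + _) => r1 r0 hm hn.
have := ler_wpM2r d0 hm; have := ler_wpM2l r0 xa; have := ler_wpM2l r1 yb.
lra.
Qed.

End Hull.

(** * The dual norm *)

Section Dual.
Context {R : realType} {k : field_kind}.
Local Notation F := (scalars R k).
Implicit Types V : normedModType F.

Lemma re_le_rnorm (x : F^o) : re (x : F) <= rnorm x.
Proof. exact: re_le_norm. Qed.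

Lemma dual_sphere_le V (f : {linear V -> F^o}) :
  dual_sphere f -> forall x, rnorm (f x) <= rnorm x.
Proof.
move=> [_ f1] x.
(* An unbounded set has supremum 0, so the norm being 1 forces boundedness. *)
have supf : has_sup [set rnorm (f x) | x in @unit_ball _ _ V].
  by apply: contrapT => /sup_out; rewrite -/(dual_norm f) f1 => /eqP; rewrite oner_eq0.
have ball y : rnorm y <= 1 -> rnorm (f y) <= 1.
  move=> y1; rewrite -f1; apply: (sup_upper_bound supf).
  by exists y => //; apply/unit_ballE.
have [->|x0] := eqVneq x 0; first by rewrite linear0 /rnorm !normr0.
have nx0 : `|x| != 0 by rewrite normr_eq0.
have xi0 : 0 <= `|x|^-1 by rewrite invr_ge0.
have nxE : re `|x|^-1 * rnorm x = 1.
  by rewrite /rnorm -reM_ge0 // mulVf // re1.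
have := ball (`|x|^-1 *: x); rewrite linearZ /= !rnormZ_ge0 // nxE => /(_ (lexx _)).
by move=> /(ler_wpM2r (rnorm_ge0 x)); rewrite mul1r mulrAC nxE mul1r.
Qed.

Lemma dual_sphere_normalize V (g : {linear V -> F^o}) (u : V) :
  (forall x, rnorm (g x) <= rnorm x) -> unit_ball u -> 0 < re (g u) ->
  exists2 h : {linear V -> F^o}, dual_sphere h &
    forall x, 0 <= re (g x) -> re (g x) <= re (h x).
Proof.
move=> g1 uB gu.
have ubg : ubound [set rnorm (g x) | x in @unit_ball _ _ V] 1.
  by move=> _ [x /unit_ballE x1 <-]; exact: le_trans (g1 x) x1.
have supg : has_sup [set rnorm (g x) | x in @unit_ball _ _ V].
  by split; [exists (rnorm (g u)), u|exists 1].
set n := dual_norm g.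
have gn x : unit_ball x -> rnorm (g x) <= n.
  by move=> xB; apply: (sup_upper_bound supg); exists x.
have n1 : n <= 1 by apply: ge_sup => //; case: supg.
have n0 : 0 < n by rewrite (lt_le_trans gu) // (le_trans (re_le_rnorm _)) // gn.
have c0 : 0 <= @scalar_of_real R k n^-1.
  by rewrite scalar_of_real_ge0 // invr_ge0 ltW.
pose h : {linear V -> F^o} := (@scalar_of_real R k n^-1 \*: g).
have hE x : h x = scalar_of_real n^-1 *: g x by [].
have rhE x : rnorm (h x) = n^-1 * rnorm (g x).
  by rewrite hE rnormZ_ge0 // re_scalar_of_real.
have hB x : unit_ball x -> rnorm (h x) <= 1.
  by move=> xB; rewrite rhE -(mulVf (lt0r_neq0 n0)) ler_pM2l ?invr_gt0 // gn.
exists h; last first.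
  move=> x gx; rewrite hE /= [re (_ *: _)]reM_ge0 // re_scalar_of_real.
  by rewrite ler_peMl // invf_ge1.
split.
  apply: bounded_linear_continuous; apply/bounded_funP => r.
  exists (scalar_of_real n^-1 * r) => x xr.
  rewrite hE normrZ ger0_norm // ler_wpM2l // (le_trans _ xr) //.
  by rewrite -le_re //; exact: g1.
have suph : has_sup [set rnorm (h x) | x in @unit_ball _ _ V].
  split; first by exists (rnorm (h u)), u.
  by exists 1 => _ [x xB <-]; exact: hB.
apply/eqP; rewrite eq_le; apply/andP; split.
  by apply: ge_sup => [|_ [x xB <-]]; [case: suph|exact: hB].
rewrite -(ler_pM2l n0) mulr1; apply: ge_sup => [|_ [x xB <-]].
  by case: supg.
rewrite -[leLHS](mulVKf (lt0r_neq0 n0)) -rhE ler_pM2l //.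
by apply: (sup_upper_bound suph); exists x.
Qed.

End Dual.

(** * L-projections *)

Section Lprojection.
Context {R : realType} {k : field_kind}.
Local Notation F := (scalars R k).

Lemma Lprojection_rnorm (Z : normedModType F) (P : {linear Z -> Z}) :
  is_Lprojection P -> forall z, rnorm z = rnorm (P z) + rnorm (z - P z).
Proof. by move=> [_ LP] z; rewrite /rnorm [in LHS]LP raddfD. Qed.

(** The functional loses on the complementary component at most the norm of
that component, and the L-norm leaves it less than d. *)
Lemma slice_projection (Z : normedModType F) (P : {linear Z -> Z})
    (f : {linear Z -> F^o}) (a d : R) (z : Z) :
  is_Lprojection P -> (forall y, rnorm (f y) <= rnorm y) ->
  slice f a z -> 1 - d < rnorm (P z) -> 1 - (a + d) < re (f (P z)).
Proof.
move=> /Lprojection_rnorm LP f1 [/unit_ballE z1 fz] Pz.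
have := le_trans (re_le_rnorm (f (z - P z))) (f1 _).
rewrite linearB raddfB /= => fzP.
by have := LP z; lra.
Qed.

(** The projection corestricted to its range, so that convex hulls can be
transported into X by a linear map. *)
Lemma Lsummand_projection (Z : completeNormedModType F) (X : set Z)
    (hX : is_Lsummand X) :
  exists (P : {linear Z -> Z}) (p : {linear Z -> Lsummand hX}),
    [/\ is_Lprojection P, forall z, val (p z) = P z & forall x, p (val x) = x].
Proof.
have [P LP XE] := hX; exists P.
have PX z : Lsummand_pred hX (P z).
  by rewrite /Lsummand_pred; apply/mem_set; rewrite XE; exists z.
pose p z : Lsummand hX := exist _ (P z) (PX z).
have p_linear : linear p.
  by move=> a x y; apply/val_inj; rewrite linearP /= linearP.
pose pL := HB.pack_for {linear Z -> Lsummand hX} p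
  (GRing.isLinear.Build _ _ _ _ p p_linear).
exists pL; split=> // -[x xX]; apply/val_inj => /=.
by move: (xX); rewrite /Lsummand_pred XE => /set_mem[y _ <-]; case: LP => ->.
Qed.

End Lprojection.

Theorem theorem3 (R : realType) (k : field_kind)
    (Z : completeNormedModType (scalars R k)) (X : set Z)
    (hX : is_Lsummand X) :
  lush Z -> lush (Lsummand hX).
Proof.
move=> lushZ u v u1 v1 eps eps0.
have [P [p [LP valp pK]]] := Lsummand_projection hX.
have rnorm_val (x : Lsummand hX) : rnorm (val x) = rnorm x by [].
have rnormp z : rnorm (p z) <= rnorm z.
  by rewrite -rnorm_val valp (Lprojection_rnorm LP z) lerDl rnorm_ge0.
pose e := Num.min eps 1.
have e0 : 0 < e by rewrite lt_min eps0 ltr01.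
have [e_eps e1] : e <= eps /\ e <= 1 by rewrite /e !ge_min !lexx orbT.
pose d := e / 2; pose eta := e ^+ 2 / 5.
have d0 : 0 < d by rewrite divr_gt0.
have eta0 : 0 < eta by rewrite divr_gt0 // exprn_gt0.
have eta_d : eta + d <= e by rewrite /eta /d; nra.
have [f [fS [_ fu]]] := lushZ (val u) (val v) u1 v1 eta eta0.
move=> /dist_set_ltP[w w_hull vw].
have f1 := dual_sphere_le fS.
pose g : {linear Lsummand hX -> _} := f \o val.
have gE x : g x = f (val x) by [].
have ru1 : rnorm u = 1 by apply/unit_sphereE.
have rv1 : rnorm v = 1 by apply/unit_sphereE.
have uB : unit_ball u by apply/unit_ballE; rewrite ru1.
have gu0 : 0 < re (g u) by rewrite gE; lra.
have [h hS gh] := @dual_sphere_normalize _ _ _ g u (fun x => f1 _) uB gu0.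
have h_slice x : rnorm x <= 1 -> 1 - e < re (g x) -> slice h eps x.
  move=> x1 gx; split; first exact/unit_ballE.
  by have := gh x; lra.
exists h; split=> //; first by apply: h_slice; rewrite ?ru1 // gE; lra.
apply/dist_set_ltP.
(* u stands in for the points whose X-component has small norm. *)
have uA : torus_mul (slice h eps) u.
  exists 1; first by rewrite /= normr1.
  exists u; last by rewrite scale1r.
  by apply: h_slice; rewrite ?ru1 // gE; lra.
pose B := p @` torus_mul (slice f eta).
have rotate (c : scalars R k) z : `|c| = 1 -> rnorm (p (c *: z)) = rnorm (p z).
  by move=> c1; rewrite linearZ /= rnormZ c1 re1 mul1r.
have B1 b : B b -> rnorm b <= 1.
  move=> [_ [c c1 [z [/unit_ballE z1 _] <-]] <-].
  by rewrite rotate // (le_trans (rnormp z)).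
have BA b : B b -> 1 - d < rnorm b -> torus_mul (slice h eps) b.
  move=> [_ [c c1 [z zS <-]] <-]; rewrite rotate // => dz.
  exists c => //; exists (p z); last by rewrite linearZ.
  have [/unit_ballE z1 _] := zS.
  apply: h_slice; first exact: le_trans (rnormp z) z1.
  rewrite gE valp.
  have := slice_projection LP f1 zS; rewrite -valp rnorm_val => /(_ d dz).
  by lra.
have ru_le1 : rnorm u <= 1 by rewrite ru1.
have [a a_hull wa] := near_hull_of_large_points (ltW d0) uA ru_le1 B1 BA
  (convex_hull_linear (p := p) w_hull).
have vpw : rnorm (v - p w) < eta.
  by rewrite -{1}(pK v) -linearB (le_lt_trans (rnormp _)).
exists a => //.
have pw1 : 1 - eta < rnorm (p w).
  by have := rnormD (v - p w) (p w); rewrite subrK rv1; lra.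
have := rnormD (v - p w) (p w - a); rewrite addrA subrK => va.
have {}wa : rnorm (p w - a) <= 2 * eta / d.
  by rewrite ler_pdivlMr //; lra.
(* The two errors are at most e / 5 and 4 e / 5; the first one is strict. *)
have etaE : 2 * eta / d = e * (4 / 5).
  by rewrite /eta /d; field; rewrite gt_eqF.
have : eta <= e / 5 by rewrite /eta; nra.
lra.
Qed.
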